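(* Let $N\geq 2$ and let $P\in\overline{\mathcal{R}_N}$ be a reversible Markov transition matrix on a state space $\mathcal{X}$ of size $N$, with $\beta_\star<1$. Then for every $0<\varepsilon<1$, \[ t_{\mathrm{mix}}(\varepsilon) \leq 2\left( N + 2\log\varepsilon^{-1} - 1 + \sqrt{2(N-2)\log\varepsilon^{-1}} \right) t_{\mathrm{rel}}. \] If moreover the eigenvalues of $P$ are all nonnegative, the initial factor of $2$ can be omitted, i.e. \[ t_{\mathrm{mix}}(\varepsilon) \leq \left( N + 2\log\varepsilon^{-1} - 1 + \sqrt{2(N-2)\log\varepsilon^{-1}} \right) t_{\mathrm{rel}}. \]
   Context: A Markov transition matrix $P$ on a finite set $\mathcal{X}$ is reversible with respect to a probability distribution $\pi$ if $\pi(x)P(x,y)=\pi(y)P(y,x)$ for all $x,y\in\mathcal{X}$. Let $\mathcal{R}_N$ denote the set of $N\times N$ Markov transition matrices that are reversible with respect to a stationary distribution $\pi$ with $\pi_{\min}=\min_x\pi(x)>0$, and let $\overline{\mathcal{R}_N}$ be the closure of $\mathcal{R}_N$ in $\mathbf{R}^{N^2}$. The eigenvalues of a matrix in $\overline{\mathcal{R}_N}$ are real; they are listed with algebraic multiplicity as $\beta_1,\ldots,\beta_N$ with $\beta_N=1$, and $\beta_\star=\max\{|\beta_j| : 1\leq j\leq N-1\}$. When $\beta_\star<1$ there is a unique stationary distribution, denoted $\pi$ (it may have zero entries). The relaxation time is $t_{\mathrm{rel}}=1/(1-\beta_\star)$. For $0<\varepsilon<1$, the total variation mixing time is \[ t_{\mathrm{mix}}(\varepsilon)=\min\{t\geq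 0 \text{ integer} : \|P^t(x,\cdot)-\pi\|_{\mathrm{TV}}\leq\varepsilon \text{ for all } x\in\mathcal{X}\}, \] where $\|\mu-\nu\|_{\mathrm{TV}}=\frac12\sum_{x\in\mathcal{X}}|\mu(x)-\nu(x)|$. Here $\log$ is the natural logarithm. *)

(* Defs.v *)
From HB Require Import structures.
From mathcomp Require Import all_boot all_order all_algebra.
From mathcomp Require Import all_classical all_reals all_analysis.
Import Order.TTheory GRing.Theory Num.Theory.
Import numFieldNormedType.Exports.

Set Implicit Arguments.
Unset Strict Implicit.
Unset Printing Implicit Defensive.

Local Open Scope classical_set_scope.
Local Open Scope ring_scope.

Definition markov_matrix (R : realType) (N : nat) (P : 'M[R]_N) : Prop :=
  (forall x y, 0 <= P x y) /\ (forall x, \sum_y P x y = 1).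

Definition distribution_on (R : realType) (N : nat) (pi : 'rV[R]_N) : Prop :=
  (forall x, 0 <= pi 0 x) /\ \sum_x pi 0 x = 1.

Definition stationary (R : realType) (N : nat) (P : 'M[R]_N) (pi : 'rV[R]_N)
    : Prop :=
  distribution_on pi /\ pi *m P = pi.

Definition reversible (R : realType) (N : nat) (P : 'M[R]_N) (pi : 'rV[R]_N)
    : Prop :=
  forall x y, pi 0 x * P x y = pi 0 y * P y x.

Definition reversible_markov (R : realType) (N : nat) : set 'M[R]_N :=
  [set P | markov_matrix P /\
     exists pi : 'rV[R]_N,
       [/\ stationary P pi, forall x, 0 < pi 0 x & reversible P pi]].

(* beta j stands for the eigenvalue usually numbered j + 1, so the index
   N - 1 carries the eigenvalue 1 singled out from the others. *)
Definition eigenvalue_listing (R : realType) (N : nat) (P : 'M[R]_N)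
    (beta : 'I_N -> R) : Prop :=
  char_poly P = \prod_(j < N) ('X - (beta j)%:P) /\
  (forall j : 'I_N, j.+1 = N -> beta j = 1).

(* The values are nonnegative, so starting the maximum at 0 is harmless as
   soon as 2 <= N. *)
Definition beta_star (R : realType) (N : nat) (beta : 'I_N -> R) : R :=
  \big[Num.max/0]_(j < N | (j.+1 < N)%N) `|beta j|.

Definition t_rel (R : realType) (N : nat) (beta : 'I_N -> R) : R :=
  (1 - beta_star beta)^-1.

Definition tv_dist (R : realType) (N : nat) (mu nu : 'rV[R]_N) : R :=
  2^-1 * \sum_x `|mu 0 x - nu 0 x|.

Definition mixed (R : realType) (N : nat) (P : 'M[R]_N) (pi : 'rV[R]_N)
    (eps : R) (t : nat) : Prop :=
  forall x, tv_dist (row x (P ^+ t)) pi <= eps.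

(* A relation rather than a total function: the minimum has no value when
   the chain never mixes to within eps. *)
Definition is_t_mix (R : realType) (N : nat) (P : 'M[R]_N) (pi : 'rV[R]_N)
    (eps : R) (t : nat) : Prop :=
  mixed P pi eps t /\ (forall s, mixed P pi eps s -> (t <= s)%N).

(* Main.v *)
Require Import Defs.
From HB Require Import structures.
From mathcomp Require Import all_boot all_order all_algebra.
From mathcomp Require Import complex.
From mathcomp Require Import all_classical all_reals all_analysis.
From mathcomp Require Import zify ring lra.
Import Order.TTheory GRing.Theory Num.Theory.
Import numFieldNormedType.Exports.

(** Let [s] be the sorted list of the eigenvalues b_0 <= ... <= b_(N-1) = 1
    of [P], and let Q_k = (P - b_0) ... (P - b_(k-1)) be its Newton products.

    The theorem of Micchelli and Willoughby ([micchelli_willoughby]) says that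
    for a Hermitian matrix with nonnegative entries all the Q_k have
    nonnegative entries.  It is proved by induction on the size: the entries
    of the adjugate of X - P are, on one hand, combinations of the products
    (X - b_(k+1)) ... (X - b_(N-1)) with the entries of Q_k as coefficients
    ([adj_char_poly_mx]) and, on the other hand, nonnegative combinations of
    the same products formed with the eigenvalues of a principal submatrix
    ([adj_off_diag]); Cauchy interlacing ([interlacing]) re-expands the latter
    into the former with nonnegative coefficients ([tail_cone_interlace]).
    Conjugating by the square root of the stationary law transfers this to
    reversible matrices, and since sorted spectra of stochastic matrices lie
    in a compact cube, the property passes to the closure
    ([closure_newton]).

    If moreover the eigenvalues are nonnegative, then P^t = sum_k c_(t,k) Q_k
    with c_(t,k) >= 0 ([pow_newton]).  As Q_k has constant row sums w_k, the
    numbers c_(t,k) w_k form the law at time t of a pure birth chain on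
    {0, ..., N-1} which holds at k with probability b_k.  The last product
    Q_(N-1) is the adjugate of 1 - P; since 1 is a simple eigenvalue all its
    rows are multiples of pi ([newton_stationary]).  Hence
    P^t(x, y) >= (1 - e) pi(y), where e is the probability that the birth
    chain has not been absorbed at N-1 by time t, and the total variation
    distance is at most e.  Before absorption each jump has probability at
    least p = 1 - beta_star, so e is at most the probability that a binomial
    variable with parameters t and p does not exceed N - 2, and the Chernoff
    bound for the latter holds for e ([birth_tail_le]).

    For eigenvalues of arbitrary sign the result is applied to P^2, whose
    eigenvalues are the squares of those of P. *)

Set Implicit Arguments.
Unset Strict Implicit.
Unset Printing Implicit Defensive.

Local Open Scope classical_set_scope.
Local Open Scope ring_scope.

(** * Newton products of a matrix *)

(** The Newton product of [A] along [s]: the product of the [A - x] for [x]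
    in [s].  It makes sense for matrices of any size, including size 0. *)
Definition newton (F : comPzRingType) n (A : 'M[F]_n) (s : seq F) : 'M[F]_n :=
  \prod_(x <- s) (A - x%:M).

Lemma newton_nil (F : comPzRingType) n (A : 'M[F]_n) : newton A [::] = 1%:M.
Proof. by rewrite /newton big_nil. Qed.

Lemma newton_rcons (F : comPzRingType) n (A : 'M[F]_n) s x :
  newton A (rcons s x) = newton A s *m (A - x%:M).
Proof. by rewrite /newton -cats1 big_cat big_seq1. Qed.

Lemma newton_take (F : comPzRingType) n (A : 'M[F]_n) s m :
  (m < size s)%N ->
  newton A (take m.+1 s) = newton A (take m s) *m (A - (nth 0 s m)%:M).
Proof. by move=> ms; rewrite (take_nth 0 ms) newton_rcons. Qed.

Lemma newton_horner (F : comNzRingType) n (A : 'M[F]_n.+1) s :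
  newton A s = horner_mx A (\prod_(x <- s) ('X - x%:P)).
Proof.
rewrite rmorph_prod; apply: eq_bigr => x _.
by rewrite rmorphB /= horner_mx_X horner_mx_C.
Qed.

Lemma size_spectrum (F : idomainType) n (A : 'M[F]_n) s :
  char_poly A = \prod_(x <- s) ('X - x%:P) -> size s = n.
Proof.
by move=> /(congr1 (fun p : {poly F} => size p));
  rewrite size_char_poly size_prod_XsubC => -[].
Qed.

(** The Cayley-Hamilton theorem in terms of Newton products. *)
Lemma newton_full (F : idomainType) n (A : 'M[F]_n) s :
  char_poly A = \prod_(x <- s) ('X - x%:P) -> newton A s = 0.
Proof.
case: n A => [|n] A hA; first by apply/matrixP => -[].
by rewrite newton_horner -hA Cayley_Hamilton.
Qed.

(** Newton expansion of the adjugate of [X - A]: multiplied by [X - A], the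
    right-hand side telescopes to the characteristic polynomial, by
    Cayley-Hamilton. *)
Lemma adj_char_poly_mx (F : idomainType) n (A : 'M[F]_n) s :
  char_poly A = \prod_(x <- s) ('X - x%:P) ->
  \adj (char_poly_mx A) =
  \sum_(m < n) (\prod_(x <- drop m.+1 s) ('X - x%:P)) *:
     map_mx polyC (newton A (take m s)).
Proof.
move=> hA; have szs := size_spectrum hA.
have det0 : \det (char_poly_mx A) != 0.
  exact: monic_neq0 (char_poly_monic A).
set Z := char_poly_mx A; set S := \sum_(m < n) _.
suff SZ : S *m Z = (\det Z)%:M.
  apply/eqP; rewrite -subr_eq0; apply/eqP.
  have : (\adj Z - S) *m (Z *m \adj Z) = 0.
    by rewrite mulmxA mulmxBl SZ mul_adj_mx subrr mul0mx.
  rewrite mul_mx_adj mul_mx_scalar => /eqP; rewrite scalemx_eq0 (negbTE det0) /=.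
  by move/eqP.
pose T m := (\prod_(x <- drop m s) ('X - x%:P)) *:
     map_mx polyC (newton A (take m s)).
have -> : (\det Z)%:M = T 0%N - T n.
  rewrite /T drop0 take0 (@take_oversize _ n) ?szs // (newton_full hA) map_mx0 scaler0 subr0.
  by rewrite newton_nil map_mx1 -hA scalemx1.
rewrite -opprB -(@telescope_sumr _ 0%N n T) // big_mkord -sumrN mulmx_suml.
apply: eq_bigr => m _; rewrite /T opprB.
have ms : (m < size s)%N by rewrite szs.
rewrite (drop_nth 0 ms) big_cons newton_take // map_mxM map_mxB map_scalar_mx.
set a := nth 0 s m; set E := \prod_(j <- _) _; set Q := map_mx _ _.
have -> : Z = ('X - a%:P)%:M - (map_mx polyC A - (a%:P)%:M).
  by rewrite /Z /char_poly_mx raddfB /= opprB addrA subrK.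
by rewrite mulmxBr mul_mx_scalar scalerA -scalemxAl.
Qed.

(** * Nonnegative combinations of tail products *)

(** The product of the [X - x] where [x] ranges over [s] with its first [m]
    items removed. *)
Definition tail_prod (F : nzRingType) (s : seq F) (m : nat) : {poly F} :=
  \prod_(x <- drop m s) ('X - x%:P).

Lemma tail_prod0 (F : nzRingType) (s : seq F) :
  tail_prod s 0 = \prod_(x <- s) ('X - x%:P).
Proof. by rewrite /tail_prod drop0. Qed.

Lemma tail_prodS (F : nzRingType) (s : seq F) m :
  (m < size s)%N -> tail_prod s m = ('X - (nth 0 s m)%:P) * tail_prod s m.+1.
Proof. by move=> ms; rewrite /tail_prod (drop_nth 0 ms) big_cons. Qed.

(** These polynomials have distinct degrees. *)
Lemma tail_prod_free (F : idomainType) (s : seq F) (c : nat -> F) :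
  \sum_(m < size s) c m *: tail_prod s m.+1 = 0 ->
  forall m, (m < size s)%N -> c m = 0.
Proof.
elim: s c => [|x s IH] c //=.
rewrite big_ord_recl.
under eq_bigr => i _ do rewrite /tail_prod /=.
rewrite /tail_prod /= drop0 => h0.
(* Compare the coefficients of degree [size s]. *)
have c0 : c 0%N = 0.
  have := congr1 (fun p : {poly F} => p`_(size s)) h0.
  rewrite coefD coefZ coef0 coef_sum [X in _ + X]big1 => [|i _].
    rewrite addr0.
    have := monic_prod_XsubC s xpredT (fun x : F => x) => /= /monicP.
    by rewrite /lead_coef size_prod_XsubC /= => ->; rewrite mulr1.
  rewrite coefZ nth_default ?mulr0 // size_prod_XsubC size_drop /=.
  by rewrite /bump /= add1n; have := ltn_ord i; lia.
move: h0; rewrite c0 scale0r add0r => h0.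
case=> [|m] //; rewrite ltnS => ms.
by apply: (IH (fun m => c m.+1)) => //; rewrite -h0; apply: eq_bigr.
Qed.

(** The cone of the polynomials that are nonnegative combinations of the tail
    products of index at least [k], the empty product included. *)
Definition tail_cone (C : numDomainType) (s : seq C) (k : nat) (p : {poly C}) :=
  exists2 c : nat -> C, (forall m, 0 <= c m) &
    p = \sum_(k <= m < (size s).+1) c m *: tail_prod s m.

Section TailCone.
Variables (C : numDomainType) (s : seq C).

Lemma tail_cone_tail k m : (k <= m <= size s)%N ->
  tail_cone s k (tail_prod s m).
Proof.
move=> /andP[km ms]; exists (fun i => (i == m)%:R) => [i|]; first exact: ler0n.
rewrite (bigD1_seq m) ?mem_index_iota ?iota_uniq ?km //= eqxx scale1r big1 ?addr0 //.
by move=> i /negbTE ->; rewrite scale0r.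
Qed.

Lemma tail_coneD k p q :
  tail_cone s k p -> tail_cone s k q -> tail_cone s k (p + q).
Proof.
move=> [c c0 ->] [d d0 ->]; exists (fun m => c m + d m) => [m|].
  exact: addr_ge0.
by rewrite -big_split; apply: eq_bigr => m _; rewrite scalerDl.
Qed.

Lemma tail_cone0 k : tail_cone s k 0.
Proof. by exists (fun=> 0) => // ; rewrite big1 // => m _; rewrite scale0r. Qed.

Lemma tail_coneZ k a p : 0 <= a -> tail_cone s k p -> tail_cone s k (a *: p).
Proof.
move=> a0 [c c0 ->]; exists (fun m => a * c m) => [m|]; first exact: mulr_ge0.
by rewrite scaler_sumr; apply: eq_bigr => m _; rewrite scalerA.
Qed.

Lemma tail_cone_sum k (I : Type) (r : seq I) (Q : pred I) (p : I -> {poly C}) :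
  (forall i, Q i -> tail_cone s k (p i)) ->
  tail_cone s k (\sum_(i <- r | Q i) p i).
Proof.
by move=> h; apply: big_ind => //; [exact: tail_cone0 | exact: tail_coneD].
Qed.

Lemma tail_coneW k k' p : (k <= k')%N -> tail_cone s k' p -> tail_cone s k p.
Proof.
move=> kk' [c c0 ->]; rewrite big_nat; apply: tail_cone_sum => m /andP[k'm ms].
apply: tail_coneZ => //; apply: tail_cone_tail.
by rewrite (leq_trans kk').
Qed.

(** Multiplication by [X - mu] sends tail products to the cone, because the
    factor [X - mu] is [X - s_m] plus the constant [s_m - mu], and
    [X - s_m] turns the tail product of index [m + 1] into that of index [m]. *)
Lemma tail_coneM k mu p :
  (forall m, (k <= m < size s)%N -> mu <= nth 0 s m) ->
  tail_cone s k.+1 p -> tail_cone s k (('X - mu%:P) * p).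
Proof.
move=> hmu [c c0 ->]; rewrite mulr_sumr big_nat; apply: tail_cone_sum.
move=> [|m] // /andP[km ms]; rewrite -scalerAr; apply: tail_coneZ => //.
have -> : ('X - mu%:P) * tail_prod s m.+1 =
  tail_prod s m + (nth 0 s m - mu) *: tail_prod s m.+1.
  by rewrite (tail_prodS ms) -mul_polyC polyCB; ring.
apply: tail_coneD; first by apply: tail_cone_tail; lia.
apply: tail_coneZ; last by apply: tail_cone_tail; lia.
by rewrite subr_ge0 hmu //; lia.
Qed.

(** If the items of [t] are dominated by those of [s] of larger index, then
    the tail products of [t] are nonnegative combinations of those of [s]. *)
Lemma tail_cone_interlace (t : seq C) :
  size s = (size t).+1 ->
  (forall i j, (i < j < size s)%N -> nth 0 t i <= nth 0 s j) ->
  forall k, (k <= size t)%N -> tail_cone s k.+1 (tail_prod t k).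
Proof.
move=> hs hst k /subKn <-; elim: (size t - k)%N => [|l IH].
  rewrite subn0; have -> : tail_prod t (size t) = tail_prod s (size s).
    by rewrite /tail_prod !drop_size.
  by apply: tail_cone_tail; rewrite hs leqnn.
have [lt|lt] := leqP l.+1 (size t); last first.
  by have -> : (size t - l.+1 = size t - l)%N by lia.
have hl : (size t - l.+1 < size t)%N by lia.
rewrite (tail_prodS hl).
have e : ((size t - l.+1).+1 = size t - l)%N by lia.
rewrite e; apply: tail_coneM => // m hm; apply: hst; lia.
Qed.

End TailCone.

(** The coefficients on the tail products of positive index are unique, hence
    nonnegative on the cone. *)
Lemma tail_cone_coef (C : numDomainType) (s : seq C) (c : nat -> C) :
  tail_cone s 1 (\sum_(m < size s) c m *: tail_prod s m.+1) ->
  forall m, (m < size s)%N -> 0 <= c m.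
Proof.
move=> [d d0]; rewrite big_add1 big_mkord => e m ms.
suff : c m - d m.+1 = 0 by move/eqP; rewrite subr_eq0 => /eqP ->.
apply: (@tail_prod_free _ s (fun m => c m - d m.+1)) => //.
under eq_bigr => i _ do rewrite scalerBl.
by rewrite sumrB e subrr.
Qed.

(** * Cauchy interlacing for Hermitian matrices *)

Lemma char_poly_similar (F : fieldType) n (A B U : 'M[F]_n) : U \in unitmx ->
  A = invmx U *m B *m U -> char_poly A = char_poly B.
Proof.
move=> Uu ->; rewrite /char_poly.
set V := map_mx polyC U; set W := map_mx polyC (invmx U).
have WV : W *m V = 1%:M by rewrite -map_mxM mulVmx // map_mx1.
have -> : char_poly_mx (invmx U *m B *m U) = W *m char_poly_mx B *m V.
  rewrite /char_poly_mx mulmxBr mulmxBl mul_mx_scalar -scalemxAl WV.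
  by rewrite scalemx1 !map_mxM.
by rewrite !det_mulmx mulrAC -det_mulmx WV det1 mul1r.
Qed.

Section Interlacing.
Local Open Scope sesquilinear_scope.
Variable C : numClosedFieldType.

Lemma hermitian_char_poly n (A : 'M[C]_n) : A \is hermsymmx ->
  char_poly A = \prod_(i < n) ('X - (spectral_diag A 0 i)%:P).
Proof.
move=> hA; have /orthomx_spectralP e := hermitian_normalmx hA.
rewrite (char_poly_similar (spectral_unit A) e) char_poly_trig ?diag_mx_is_trig //.
by apply: eq_bigr => i _; rewrite mxE eqxx mulr1n.
Qed.

(** The shifted quadratic form of [A] in an orthonormal system, the rows of
    [Q], in which [A] is diagonal. *)
Lemma form_diag p n (A : 'M[C]_n) (Q : 'M[C]_(p, n)) (e : 'rV[C]_p) a (u : 'rV[C]_p) :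
  Q *m Q^t* = 1%:M -> Q *m A *m Q^t* = diag_mx e ->
  ((u *m Q) *m (A - a%:M) *m (u *m Q)^t*) 0 0 =
  \sum_l (e 0 l - a) * `|u 0 l| ^+ 2.
Proof.
move=> Qu QA.
have -> : (u *m Q) *m (A - a%:M) *m (u *m Q)^t* =
  u *m (diag_mx e - a%:M) *m u^t*.
  have <- : Q *m (A - a%:M) *m Q^t* = diag_mx e - a%:M.
    by rewrite mulmxBr mulmxBl QA mul_mx_scalar -scalemxAl Qu scalemx1.
  by rewrite trmx_mul map_mxM !mulmxA.
rewrite -diag_const_mx -raddfB /= mul_mx_diag mxE; apply: eq_bigr => l _.
by rewrite !mxE mulrAC normCK mulrC.
Qed.

(** Selected rows of the spectral matrix form such a system. *)
Lemma rowsub_spectral n (A : 'M[C]_n) p (f : 'I_p -> 'I_n) :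
  A \is hermsymmx -> injective f ->
  let Q := rowsub f (spectralmx A) in
  Q *m Q^t* = 1%:M /\
  Q *m A *m Q^t* = diag_mx (\row_l spectral_diag A 0 (f l)).
Proof.
move=> hA fI Q; have U := spectral_unitarymx A.
have UU := unitarymxP U.
have e (X : 'M[C]_n) i j : (Q *m X *m Q^t*) i j =
    (spectralmx A *m X *m (spectralmx A)^t*) (f i) (f j).
  rewrite -!mulmxA !mxE; apply: eq_bigr => k _.
  rewrite !mxE; congr (_ * _); apply: eq_bigr => l _.
  by rewrite !mxE.
split.
  rewrite -[Q in Q *m _]mulmx1; apply/matrixP => i j.
  by rewrite e mulmx1 UU !mxE (inj_eq fI).
have /orthomx_spectralP eA := hermitian_normalmx hA.
apply/matrixP => i j; rewrite e {2}eA invmx_unitary // !mulmxA UU mul1mx.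
by rewrite -mulmxA UU mulmx1 !mxE (inj_eq fI).
Qed.

Lemma principal_hermitian n (A : 'M[C]_n.+1) j :
  A \is hermsymmx -> row' j (col' j A) \is hermsymmx.
Proof.
move=> /is_hermitianmxP; rewrite expr0 scale1r => hA.
by apply/is_hermitianmxP; rewrite expr0 scale1r {1}hA; apply/matrixP=> i k;
  rewrite !mxE.
Qed.

(** Any listing of the roots of the characteristic polynomial is a permutation
    of the spectral diagonal. *)
Lemma count_spectral n (A : 'M[C]_n) s (Q : pred C) : A \is hermsymmx ->
  char_poly A = \prod_(x <- s) ('X - x%:P) ->
  count Q s = #|[pred i | Q (spectral_diag A 0 i)]|.
Proof.
move=> hA; rewrite hermitian_char_poly // => e.
have : perm_eq s [seq spectral_diag A 0 i | i <- enum 'I_n].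
  by apply: prod_XsubC_eq; rewrite -e big_map big_enum.
move/permP/(_ Q) => ->; rewrite count_map cardE size_filter.
by rewrite -enumT; apply: eq_count.
Qed.

Lemma hermitian_spectrum_real n (A : 'M[C]_n) s : A \is hermsymmx ->
  char_poly A = \prod_(x <- s) ('X - x%:P) -> {in s, forall x, x \is Num.real}.
Proof.
move=> hA e; apply/allP; rewrite all_count (count_spectral _ hA e).
rewrite (size_spectrum e); apply/eqP; rewrite -[RHS]card_ord; apply: eq_card => i.
rewrite !inE; exact: (mxOverP (hermitian_spectral_diag_real hA)).
Qed.

(** One half of Cauchy interlacing, by the Courant-Fischer argument: were the
    inequality false, with [a] the item of [s] of index [k], the span of the
    eigenvectors of [A] with eigenvalue at most [a] would meet the span of those of the principal submatrix with
    eigenvalue above [a], and the form [A - a] would have both signs at a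
    nonzero common vector. *)
Lemma interlacing n (A : 'M[C]_n.+1) j s t : A \is hermsymmx ->
  char_poly A = \prod_(x <- s) ('X - x%:P) ->
  char_poly (row' j (col' j A)) = \prod_(x <- t) ('X - x%:P) ->
  sorted <=%R s -> sorted <=%R t ->
  forall i k, (i < k < size s)%N -> nth 0 t i <= nth 0 s k.
Proof.
move=> hA es et ss st i k /andP[ik ks].
set B := row' j (col' j A) in et.
have hB : B \is hermsymmx by apply: principal_hermitian.
have szs := size_spectrum es; have szt := size_spectrum et.
have ks' : (k < n.+1)%N by rewrite -szs.
have it : (i < size t)%N by rewrite szt; lia.
rewrite real_leNgt; last 2 first.
- by apply: (hermitian_spectrum_real hB et); rewrite mem_nth.
- by apply: (hermitian_spectrum_real hA es); rewrite mem_nth.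
set a := nth 0 s k; apply/negP => a_lt.
pose I := [pred l | spectral_diag A 0 l <= a].
pose J := [pred l | a < spectral_diag B 0 l].
have cI : (k < #|I|)%N.
  rewrite -(count_spectral (fun x => x <= a) hA es) -[s](cat_take_drop k.+1).
  rewrite count_cat; apply: leq_trans (leq_addr _ _).
  have : all (fun x => x <= a) (take k.+1 s).
    apply/(all_nthP 0) => m; rewrite size_takel // => mk.
    rewrite nth_take //; apply: (sorted_leq_nth le_trans le_refl) => //.
    by rewrite inE szs; lia.
  by rewrite all_count => /eqP ->; rewrite size_takel.
have cJ : (n - i <= #|J|)%N.
  rewrite -(count_spectral (fun x => a < x) hB et) -[t](cat_take_drop i).
  rewrite count_cat; apply: leq_trans (leq_addl _ _).
  have : all (fun x => a < x) (drop i t).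
    apply/(all_nthP 0) => m; rewrite size_drop szt => mk.
    rewrite nth_drop; apply: (lt_le_trans a_lt).
    apply: (sorted_leq_nth le_trans le_refl) => //; rewrite ?inE ?szt; lia.
  by rewrite all_count => /eqP ->; rewrite size_drop szt.
have [VV VA] := rowsub_spectral hA (@enum_val_inj _ I).
have [WW WB] := rowsub_spectral hB (@enum_val_inj _ J).
set V := rowsub _ _ in VV VA; set W0 := rowsub _ _ in WW WB.
(* [E] inserts a zero at coordinate [j]; [W] holds the eigenvectors of [B]
   extended in this way. *)
pose E : 'M[C]_(n, n.+1) := rowsub (lift j) 1%:M.
have EX (X : 'M[C]_n.+1) : E *m X *m E^t* = row' j (col' j X).
  rewrite -mulmxA /E -rowsubE; apply/matrixP => u v.
  rewrite !mxE (bigD1 (lift j v)) //= big1 ?addr0.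
    by rewrite !mxE eqxx rmorph1 mulr1.
  move=> l lv; rewrite !mxE eq_sym (negbTE lv) ?rmorph0 ?mulr0 //.
pose W := W0 *m E.
have EE : E *m E^t* = 1%:M.
  have := EX 1%:M; rewrite mulmx1 => ->.
  by apply/matrixP => u v; rewrite !mxE (inj_eq lift_inj).
have WWt : W *m W^t* = 1%:M.
  by rewrite /W trmx_mul map_mxM !mulmxA -[W0 *m E *m _]mulmxA EE mulmx1.
have WA : W *m A *m W^t* = diag_mx (\row_l spectral_diag B 0 (@enum_val _ J l)).
  by rewrite /W trmx_mul map_mxM !mulmxA -[W0 *m E *m _]mulmxA
     -[W0 *m _ *m _]mulmxA EX WB.
have : \rank (V :&: W)%MS != 0%N.
  have := mxrank_sum_cap V W.
  rewrite (mxrank_unitary (introT unitarymxP VV)).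
  rewrite (mxrank_unitary (introT unitarymxP WWt)).
  move=> rk; apply/eqP => cap0; rewrite cap0 addn0 in rk.
  have := leq_trans (leq_add cI cJ) _; rewrite -rk => /(_ _ (rank_leq_col _)).
  by lia.
(* A common vector [v], which makes the two expressions of the form [A - a]
   contradict each other. *)
rewrite mxrank_eq0 => /rowV0Pn [v]; rewrite sub_capmx => /andP[/submxP[x xE] /submxP[y yE]].
move=> v0.
have := form_diag a x VV VA; rewrite -xE yE (form_diag a y WWt WA).
have : 0 < \sum_l ((\row_l spectral_diag B 0 (@enum_val _ J l)) 0 l - a) * `|y 0 l| ^+ 2.
  have y0 : y != 0 by apply: contraNneq v0 => y0; rewrite yE y0 mul0mx.
  have /existsP[l yl] : [exists l, y 0 l != 0].
    apply: contraNT y0 => /existsPn h; apply/eqP/rowP => l; rewrite mxE.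
    by apply/eqP; have := h l; rewrite negbK.
  rewrite (bigD1 l) //=; apply: ltr_wpDr.
    apply: sumr_ge0 => m _; rewrite mxE mulr_ge0 ?exprn_ge0 ?subr_ge0 //.
    by have /ltW : a < spectral_diag B 0 (enum_val m) := enum_valP m.
  rewrite mxE mulr_gt0 ?exprn_gt0 ?normr_gt0 // subr_gt0.
  exact: (enum_valP l : a < spectral_diag B 0 (enum_val l)).
move=> pos e; move: pos; rewrite e => /lt_geF/negbT/negP; apply.
apply: sumr_le0 => m _; rewrite mxE mulr_le0_ge0 ?exprn_ge0 // subr_le0.
exact: (enum_valP m : spectral_diag A 0 (enum_val m) <= a).
Qed.
End Interlacing.

(** * The Micchelli-Willoughby theorem *)

Lemma adj_diag (F : idomainType) n (A : 'M[F]_n.+1) j :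
  \adj (char_poly_mx A) j j = char_poly (row' j (col' j A)).
Proof.
rewrite mxE /cofactor row'_col'_char_poly_mx.
by rewrite -signr_odd addnn odd_double mul1r.
Qed.

(** Off-diagonal entries of column [j] of the adjugate, from the adjugate of
    the submatrix with row and column [j] deleted: the rows other than [j]
    of the product of [X - A] and its adjugate form a linear system for these entries. *)
Lemma adj_off_diag (F : idomainType) n (A : 'M[F]_n.+1) j i :
  \adj (char_poly_mx A) (lift j i) j =
  \sum_l A (lift j l) j *: \adj (char_poly_mx (row' j (col' j A))) i l.
Proof.
set Z := char_poly_mx A; set B := row' j (col' j A); set ZB := char_poly_mx B.
pose v : 'cV_n := \col_i \adj Z (lift j i) j.
pose b : 'cV_n := \col_l (A (lift j l) j)%:P.
have dn0 : \det ZB != 0 by exact: monic_neq0 (char_poly_monic B).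
have e : ZB *m v = \det ZB *: b.
  apply/colP => r; rewrite !mxE.
  have := congr1 (fun M : 'M[{poly F}]_n.+1 => M (lift j r) j) (mul_mx_adj Z).
  rewrite !mxE (bigD1_ord j) //= adj_diag -/B -/ZB eq_sym (negbTE (neq_lift _ _)) mulr0n.
  rewrite /char_poly -/ZB.
  have -> : Z (lift j r) j = - (A (lift j r) j)%:P.
    by rewrite !mxE eq_sym (negbTE (neq_lift _ _)) mulr0n add0r.
  move/eqP; rewrite mulNr addrC subr_eq0 [RHS]mulrC => /eqP <-.
  by apply: eq_bigr => l _; rewrite !mxE (inj_eq lift_inj).
have ev : v = \adj ZB *m b.
  apply: (scalemx_inj dn0); rewrite scalemxAr -e mulmxA.
  by rewrite mul_adj_mx mul_scalar_mx.
have := congr1 (fun M : 'cV_n => M i 0) ev; rewrite /= !mxE => ->.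
by apply: eq_bigr => l _; rewrite !mxE mulrC mul_polyC.
Qed.

(** The eigenvalues are taken in increasing order; this is essential for the
    partial products to be nonnegative. *)
Theorem micchelli_willoughby (C : numClosedFieldType) n (A : 'M[C]_n) s :
  A \is hermsymmx -> (forall i j, 0 <= A i j) ->
  char_poly A = \prod_(x <- s) ('X - x%:P) -> sorted <=%R s ->
  forall m i j, 0 <= newton A (take m s) i j.
Proof.
elim: n A s => [|n IH] A s hA A0 es ss m i j; first by case: i.
have szs := size_spectrum es.
have [ms|ms] := ltnP m n.+1; last first.
  by rewrite take_oversize ?szs // newton_full // mxE.
pose B := row' j (col' j A).
have hB : B \is hermsymmx by exact: principal_hermitian.
have B0 k l : 0 <= B k l by rewrite !mxE.
(* Column [j] of the adjugate is governed by the submatrix [B], to which the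
   induction hypothesis applies. *)
pose t := sort <=%R [seq spectral_diag B 0 k | k <- enum 'I_n].
have et : char_poly B = \prod_(x <- t) ('X - x%:P).
  rewrite hermitian_char_poly // (perm_big _ (permEl (perm_sort _ _))) /=.
  by rewrite big_map big_enum.
have st : sorted <=%R t.
  apply: (@sort_sorted_in _ Num.real).
    by move=> x y xR yR; exact: real_leVge.
  apply/allP => x /mapP[k _ ->].
  exact: (mxOverP (hermitian_spectral_diag_real hB)).
have szt := size_spectrum et.
have inter := interlacing hA es et ss st.
have cone k : (k <= n)%N -> tail_cone s k.+1 (tail_prod t k).
  by move=> kn; apply: tail_cone_interlace => //; rewrite szt ?szs.
suff : tail_cone s 1 (\adj (char_poly_mx A) i j).
  rewrite (adj_char_poly_mx es) summxE.
  under eq_bigr => k _ do rewrite !mxE mulrC mul_polyC.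
  move=> h; apply: (@tail_cone_coef _ s (fun k => newton A (take k s) i j)).
    by rewrite szs.
  by rewrite szs.
have [->|ij] := eqVneq i j.
  by rewrite adj_diag et -tail_prod0; apply: cone.
have [k ->] : exists k, i = lift j k.
  by case: (unliftP j i) ij => [k ->|->]; [exists k | rewrite eqxx].
rewrite adj_off_diag; apply: tail_cone_sum => l _; apply: tail_coneZ => //.
rewrite (adj_char_poly_mx et) summxE; apply: tail_cone_sum => q _.
rewrite !mxE mulrC mul_polyC; apply: tail_coneZ; first exact: IH.
apply: (@tail_coneW _ _ _ q.+2) => //; exact: cone.
Qed.

(** * Reversible matrices *)

Lemma newton_similar (F : fieldType) n (A B U : 'M[F]_n) s : U \in unitmx ->
  A = invmx U *m B *m U -> newton A s = invmx U *m newton B s *m U.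
Proof.
move=> Uu eA; elim/last_ind: s => [|s x IH].
  by rewrite !newton_nil mulmx1 mulVmx.
rewrite !newton_rcons IH eA.
have -> : invmx U *m B *m U - x%:M = invmx U *m (B - x%:M) *m U.
  by rewrite mulmxBr mulmxBl mul_mx_scalar -scalemxAl mulVmx // scalemx1.
by rewrite !mulmxA mulmxK.
Qed.

Lemma map_newton (F K : comNzRingType) (f : {rmorphism F -> K}) n
    (A : 'M[F]_n) s :
  map_mx f (newton A s) = newton (map_mx f A) (map f s).
Proof.
elim/last_ind: s => [|s x IH]; first by rewrite !newton_nil map_mx1.
by rewrite map_rcons !newton_rcons map_mxM map_mxB map_scalar_mx IH.
Qed.

(** The real symmetric case, obtained from the Hermitian one over [R[i]]. *)
Lemma symmetric_newton (R : rcfType) n (A : 'M[R]_n) :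
  A^T = A -> (forall i j, 0 <= A i j) ->
  exists s : seq R, [/\ sorted <=%R s,
    char_poly A = \prod_(x <- s) ('X - x%:P) &
    forall m i j, 0 <= newton A (take m s) i j].
Proof.
move=> At A0; pose f := real_complex R; pose B := map_mx f A.
have hB : B \is hermsymmx.
  apply/is_hermitianmxP; rewrite expr0 scale1r /B -{1}At; apply/matrixP => i j.
  by rewrite !mxE; apply/esym/conj_Creal/complex_realP; exists (A j i).
have dR i : spectral_diag B 0 i = f (complex.Re (spectral_diag B 0 i)).
  by apply/esym/RRe_real; exact: (mxOverP (hermitian_spectral_diag_real hB)).
pose r := [seq complex.Re (spectral_diag B 0 i) | i <- enum 'I_n].
pose s := sort <=%R r.
have eB : char_poly B = \prod_(x <- map f s) ('X - x%:P).
  rewrite hermitian_char_poly // (perm_big _ (perm_map f (permEl (perm_sort _ r)))).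
  by rewrite /r big_map big_map big_enum; apply: eq_bigr => i _; rewrite dR.
exists s; split.
- exact: sort_le_sorted.
- apply: (map_poly_inj f); rewrite map_char_poly eB rmorph_prod big_map.
  by apply: eq_bigr => x _; rewrite rmorphB /= map_polyX map_polyC.
- move=> m i j.
  have : 0 <= newton B (take m (map f s)) i j.
    apply: micchelli_willoughby => //.
    + by move=> k l; rewrite mxE /f lecR.
    + rewrite sorted_map; apply: sub_sorted (sort_le_sorted _) => x y.
      by rewrite /= /f lecR.
  by rewrite -map_take -map_newton mxE /f ler0c.
Qed.

(** Conjugation by the diagonal matrix of the square roots of [pi] makes [P]
    symmetric and multiplies the entries by positive numbers. *)
Lemma reversible_newton (R : rcfType) n (P : 'M[R]_n) (pi : 'rV[R]_n) :
  (forall x, 0 < pi 0 x) -> (forall x y, pi 0 x * P x y = pi 0 y * P y x) ->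
  (forall x y, 0 <= P x y) ->
  exists s : seq R, [/\ sorted <=%R s,
    char_poly P = \prod_(x <- s) ('X - x%:P) &
    forall m i j, 0 <= newton P (take m s) i j].
Proof.
move=> pi0 rev P0.
pose d := \row_x Num.sqrt (pi 0 x).
pose e := \row_x (Num.sqrt (pi 0 x))^-1.
have d0 x : 0 < Num.sqrt (pi 0 x) by rewrite sqrtr_gt0.
have de : diag_mx e *m diag_mx d = 1%:M.
  rewrite mulmx_diag -diag_const_mx; congr diag_mx; apply/rowP => x.
  by rewrite !mxE mulVf // gt_eqF.
have Du : diag_mx d \in unitmx by have [] := mulmx1_unit de.
have iD : invmx (diag_mx d) = diag_mx e.
  by rewrite -[LHS]mul1mx -de mulmxK.
pose A := diag_mx d *m P *m diag_mx e.
have eA i j : A i j = Num.sqrt (pi 0 i) * P i j * (Num.sqrt (pi 0 j))^-1.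
  by rewrite /A mul_mx_diag mxE mul_diag_mx !mxE.
have eP : P = invmx (diag_mx d) *m A *m diag_mx d.
  by rewrite iD /A !mulmxA de mul1mx -mulmxA de mulmx1.
have [|i j|s [ss es ns]] := @symmetric_newton R n A.
- apply/matrixP => i j; rewrite mxE !eA.
  have ne k : Num.sqrt (pi 0 k) != 0 by rewrite gt_eqF.
  apply/eqP; rewrite eqr_div //; apply/eqP.
  have h k : Num.sqrt (pi 0 k) * Num.sqrt (pi 0 k) = pi 0 k.
    by rewrite -expr2 sqr_sqrtr // ltW.
  rewrite mulrAC h mulrAC h; exact: rev.
- by rewrite eA !mulr_ge0 ?invr_ge0 // ltW.
exists s; split=> //; first by rewrite (char_poly_similar Du eP).
move=> m i j; rewrite (newton_similar _ Du eP) iD mul_mx_diag mxE mul_diag_mx.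
by rewrite !mxE !mulr_ge0 ?invr_ge0 // ltW.
Qed.

(** * Passage to the closure *)

(** Projection along a compact factor preserves closedness. *)
Lemma closed_proj (X Y : topologicalType) (K : set X) (G : set (X * Y)) :
  compact K -> closed G ->
  closed [set y | exists2 x, K x & G (x, y)].
Proof.
move=> /compact_near_coveringP cK cG; rewrite -openC openE => y ny.
have : \forall y' \near y, K `<=` (fun x => ~ G (x, y')).
  apply: (cK Y (nbhs y) (fun y' x => ~ G (x, y'))) => x Kx.
  have : nbhs (x, y) (~` G).
    apply: open_nbhs_nbhs; split; first by rewrite openC.
    by move=> Gxy; apply: ny; exists x.
  move=> h; apply: (filterS _ (h : filter_prod (nbhs x) (nbhs y) (~` G))).
  by case.
by apply: filterS => y' h [x Kx Gx]; exact: h Gx.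
Qed.

Lemma poly_fun_eq0 (F : numDomainType) (p : {poly F}) :
  (forall x, p.[x] = 0) -> p = 0.
Proof.
move=> p0; apply: (@roots_geq_poly_eq0 _ p [seq i%:R | i <- iota 0 (size p)]).
- by apply/allP => x _; rewrite /root p0.
- rewrite map_inj_uniq ?iota_uniq // => i j /eqP; rewrite eqr_nat; exact: eqP.
- by rewrite size_map size_iota.
Qed.

Section Closure.
Variables (R : realType) (N : nat).
Notation T := ('rV[R]_N * 'M[R]_N)%type.

Lemma closed_ge0 (T' : topologicalType) (g : T' -> R) : continuous g ->
  closed [set z | 0 <= g z].
Proof. by move=> cg; have /continuous_closedP h := cg; apply: (h [set x : R | 0 <= x]); exact: closed_ge. Qed.

Lemma continuous_entry i j : continuous (fun z : T => z.2 i j).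
Proof.
move=> z; apply: (@continuous_comp _ _ _ snd (fun M : 'M[R]_N => M i j)).
  exact: cvg_snd.
exact: coord_continuous.
Qed.

Lemma continuous_coord i : continuous (fun z : T => z.1 0 i).
Proof.
move=> z; apply: (@continuous_comp _ _ _ fst (fun M : 'rV[R]_N => M 0 i)).
  exact: cvg_fst.
exact: coord_continuous.
Qed.

Lemma continuous_newton (l : seq 'I_N) i j :
  continuous (fun z : T => newton z.2 [seq z.1 0 k | k <- l] i j).
Proof.
elim/last_ind: l i j => [|l k IH] i j.
  under eq_fun => z do rewrite newton_nil.
  exact: cst_continuous.
under eq_fun => z do rewrite map_rcons newton_rcons mxE.
apply: continuous_big => [|m _]; first exact: add_continuous.
have cm : continuous (fun z : T => (z.2 - (z.1 0 k)%:M) m j).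
  under eq_fun => z do rewrite !mxE.
  move=> z; apply: cvgB; first exact: continuous_entry.
  case: (m == j); last exact: cst_continuous.
  exact: continuous_coord.
by move=> z; apply: cvgM; [exact: IH | exact: cm].
Qed.

Lemma continuous_char_poly x :
  continuous (fun z : T => (char_poly z.2).[x] - \prod_i (x - z.1 0 i)).
Proof.
have e (z : T) : (char_poly z.2).[x] = \det (x%:M - z.2).
  rewrite /char_poly -[_.[x]]/(horner_eval x _) -det_map_mx; congr (\det _).
  by apply/matrixP => i j; rewrite !mxE rmorphB rmorphMn /= /horner_eval hornerX hornerC.
have cdet : continuous (fun z : T => (char_poly z.2).[x]).
  under eq_fun => z do rewrite e.
  apply: continuous_big => [|s _]; first exact: add_continuous.
  move=> z; apply: cvgM; first exact: cst_continuous.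
  apply: continuous_big => [|i _]; first exact: mul_continuous.
  under eq_fun => w do rewrite !mxE.
  move=> {}z; apply: cvgB; first exact: cst_continuous.
  exact: continuous_entry.
move=> z; apply: cvgB; first exact: cdet.
apply: continuous_big => [|i _]; first exact: mul_continuous.
move=> {}z; apply: cvgB; first exact: cst_continuous.
exact: continuous_coord.
Qed.

(** The pairs of a vector of eigenvalues in increasing order and a matrix
    with this spectrum all of whose partial Newton products are nonnegative. *)
Definition newton_pos : set T := [set z : T |
  [/\ forall i j : 'I_N, (i <= j)%N -> z.1 0 i <= z.1 0 j,
      char_poly z.2 = \prod_i ('X - (z.1 0 i)%:P) &
      forall m i j, 0 <= newton z.2 (take m [seq z.1 0 k | k <- enum 'I_N]) i j]].

Lemma closed_newton_pos : closed newton_pos.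
Proof.
have -> : newton_pos =
    (\bigcap_(ij in [set ij : 'I_N * 'I_N | (ij.1 <= ij.2)%N])
        [set z : T | 0 <= z.1 0 ij.2 - z.1 0 ij.1]) `&`
    (\bigcap_(x in [set: R])
        [set z : T | (char_poly z.2).[x] - \prod_i (x - z.1 0 i) = 0]) `&`
    (\bigcap_(mij in [set: nat * ('I_N * 'I_N)])
        [set z : T | 0 <= newton z.2 [seq z.1 0 k | k <- take mij.1 (enum 'I_N)]
           mij.2.1 mij.2.2]).
  apply/seteqP; split => [[b M] /= [h1 h2 h3]|[b M] /= [[h1 h2] h3]].
    split; first split.
    - by move=> [i j] /= ij; rewrite subr_ge0 h1.
    - move=> x _ /=; rewrite h2 horner_prod; apply/eqP; rewrite subr_eq0; apply/eqP.
      by apply: eq_bigr => i _; rewrite hornerXsubC.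
    - by move=> [m [i j]] _ /=; rewrite map_take.
  split.
  - by move=> i j ij; rewrite -subr_ge0; exact: (h1 (i, j)).
  - apply/eqP; rewrite -subr_eq0; apply/eqP.
    apply: poly_fun_eq0 => x; rewrite hornerD hornerN horner_prod -[RHS](h2 x) //.
    by congr (_ - _); apply: eq_bigr => i _; rewrite hornerXsubC.
  - by move=> m i j; rewrite -map_take; exact: (h3 (m, (i, j))).
apply: closedI; first apply: closedI.
- apply: closed_bigI => -[i j] _; apply: closed_ge0 => z.
  by apply: cvgB; exact: continuous_coord.
- apply: closed_bigI => x _.
  have /continuous_closedP h := @continuous_char_poly x.
  by apply: (h [set y : R | y = 0]); exact: closed_eq.
- by apply: closed_bigI => -[m [i j]] _; apply: closed_ge0; exact: continuous_newton.
Qed.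
End Closure.

Section StochasticSpectrum.
Variables (R : realType) (N : nat).
Implicit Types P : 'M[R]_N.

(** A left multiplication by a stochastic matrix does not increase the sum of
    the absolute values of the coordinates. *)
Lemma markov_eigenvalue_le1 P x : markov_matrix P -> eigenvalue P x -> `|x| <= 1.
Proof.
move=> [P0 P1] /eigenvalueP [v vP v0].
have nv : 0 < \sum_i `|v 0 i|.
  rewrite lt_def sumr_ge0 ?andbT => [|i _]; last exact: normr_ge0.
  apply: contraNneq v0 => /eqP; rewrite psumr_eq0 => [|i _]; last exact: normr_ge0.
  move=> /allP h; apply/eqP/rowP => i; rewrite mxE; apply/eqP.
  by rewrite -normr_eq0; apply: h; rewrite mem_index_enum.
rewrite -(ler_pM2r nv) mul1r mulr_sumr.
rewrite [leRHS](_ : _ = \sum_j \sum_i `|v 0 i| * P i j); last first.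
  rewrite exchange_big; apply: eq_bigr => i _.
  by rewrite -mulr_sumr P1 mulr1.
apply: ler_sum => j _; rewrite -normrM.
have := congr1 (fun w : 'rV_N => w 0 j) vP; rewrite !mxE => <-.
apply: le_trans (ler_norm_sum _ _ _) _; apply: ler_sum => i _.
by rewrite normrM (ger0_norm (P0 _ _)).
Qed.

Lemma closed_markov : closed [set P : 'M[R]_N | markov_matrix P].
Proof.
have -> : [set P : 'M[R]_N | markov_matrix P] =
  (\bigcap_(xy in [set: 'I_N * 'I_N]) [set P : 'M[R]_N | 0 <= P xy.1 xy.2]) `&`
  (\bigcap_(x in [set: 'I_N]) [set P : 'M[R]_N | \sum_y P x y = 1]).
  apply/seteqP; split => P /= [h1 h2]; split.
  - by move=> [x y] _; exact: h1.
  - by move=> x _; exact: h2.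
  - by move=> x y; exact: (h1 (x, y)).
  - by move=> x; exact: (h2 x).
apply: closedI; apply: closed_bigI.
- by move=> [x y] _; apply: closed_ge0; exact: coord_continuous.
- move=> x _; have : continuous (fun P : 'M[R]_N => \sum_y P x y).
    apply: continuous_big => [|y _]; first exact: add_continuous.
    exact: coord_continuous.
  move=> /continuous_closedP h.
  by apply: (h [set y : R | y = 1]); exact: closed_eq.
Qed.

Lemma closure_markov P : closure (@reversible_markov R N) P -> markov_matrix P.
Proof.
move=> hP; suff : closure [set P : 'M[R]_N | markov_matrix P] P.
  by rewrite -((closure_id _).1 closed_markov).
by apply: closureS hP => Q [].
Qed.

(** The nonnegativity of Newton products survives in the limit: the spectra
    of the approximating matrices stay in a compact cube, their items being at
    most 1 in absolute value. *)
Theorem closure_newton P : closure (@reversible_markov R N) P ->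
  exists s : seq R, [/\ sorted <=%R s,
    char_poly P = \prod_(x <- s) ('X - x%:P) &
    forall m i j, 0 <= newton P (take m s) i j].
Proof.
pose K := [set b : 'rV[R]_N | forall i, b 0 i \in `[-1, 1]].
have cK : compact K by apply: (@rV_compact R N (fun=> `[-1, 1]%classic)) => _;
  exact: segment_compact.
have cG := closed_proj cK (@closed_newton_pos R N).
move=> hP.
suff sub : @reversible_markov R N `<=` [set P | exists2 b, K b & newton_pos (b, P)].
  have : closure [set P | exists2 b, K b & newton_pos (b, P)] P.
    exact: closureS hP.
  rewrite -((closure_id _).1 cG) => -[b _ [hb1 hb2 hb3]].
  exists [seq b 0 k | k <- enum 'I_N]; split=> //.
  - rewrite sorted_map; apply: (@sub_sorted _ (fun i j : 'I_N => (i <= j)%N)) => //.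
    by have := iota_sorted 0 N; rewrite -val_enum_ord sorted_map.
  - by rewrite hb2 big_map big_enum.
move=> Q [mQ [pi [_ pi0 rev]]].
have [s [ss es ns]] := reversible_newton pi0 rev mQ.1.
have szs := size_spectrum es.
exists (\row_i nth 0 s i).
  move=> i; rewrite mxE in_itv /= -ler_norml.
  apply: (markov_eigenvalue_le1 mQ); rewrite eigenvalue_root_char es root_prod_XsubC.
  by rewrite mem_nth ?szs.
have e : [seq (\row_i nth 0 s i) 0 k | k <- enum 'I_N] = s.
  rewrite -[RHS](mkseq_nth 0) /mkseq szs -val_enum_ord -map_comp.
  by apply: eq_map => i; rewrite /= mxE.
split=> /=.
- move=> i j ij; rewrite !mxE; apply: (sorted_leq_nth le_trans le_refl) => //;
  by rewrite inE szs.
- by rewrite es -[in LHS]e big_map big_enum.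
- by move=> m i j; rewrite e.
Qed.
End StochasticSpectrum.

(** * The pure birth chain *)

Lemma expR_ge_quadratic (R : realType) (x : R) :
  0 <= x -> 1 + x + x ^+ 2 / 2 <= expR x.
Proof.
move=> x0; have -> : 1 + x + x ^+ 2 / 2 = series (exp_coeff x) 3.
  rewrite /series /= !big_nat_recr //= big_geq // /exp_coeff /=.
  by rewrite expr0 expr1 !fact0 (_ : 2`! = 2)%N // !divr1 add0r.
rewrite /expR; apply: nondecreasing_cvgn_le; last exact: is_cvg_series_exp_coeff.
apply/nondecreasing_seqP => k; rewrite /series /= big_nat_recr //= lerDl.
by rewrite divr_ge0 // exprn_ge0.
Qed.

(** Because [(1 + x + x^2 / 2) * (1 - x + x^2 / 2) = 1 + x^4 / 4]. *)
Lemma expRN_le_quadratic (R : realType) (x : R) :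
  0 <= x -> expR (- x) <= 1 - x + x ^+ 2 / 2.
Proof.
move=> x0; rewrite expRN invf_ple ?posrE ?expR_gt0 //; last by nra.
apply: le_trans (expR_ge_quadratic x0).
rewrite -div1r ler_pdivrMr; nra.
Qed.

Section BirthChain.
Variable R : realType.
Variable b : nat -> R.

(** The complete homogeneous symmetric polynomial of degree [t - k] in
    b_0, ..., b_k: the Newton coefficients of X^t (0 if [t < k]). *)
Fixpoint birth_coef (t k : nat) : R :=
  if t is t'.+1 then
    b k * birth_coef t' k + (if k is k'.+1 then birth_coef t' k' else 0)
  else (k == 0%N)%:R.

(** The probability that a birth chain holding at [j] with probability [b j]
    makes its first [k] steps without holding.  Thus
    [birth_coef t k * birth_weight k] is the probability that it is in state
    [k] at time [t], starting from 0. *)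
Definition birth_weight k : R := \prod_(j < k) (1 - b j).

Lemma birth_coef_ge0 n t k : (forall j, (j <= n)%N -> 0 <= b j) ->
  (k <= n)%N -> 0 <= birth_coef t k.
Proof.
move=> b0; elim: t k => [|t IH] k kn /=; first exact: ler0n.
apply: addr_ge0; first by rewrite mulr_ge0 ?b0 ?IH.
by case: k kn => // k kn; apply: IH; exact: ltnW.
Qed.

Lemma birth_weightS k : birth_weight k.+1 = birth_weight k * (1 - b k).
Proof. by rewrite /birth_weight big_ord_recr. Qed.

Variables (n : nat) (p : R).
Hypotheses (p0 : 0 <= p) (p1 : p <= 1)
  (b0 : forall j, (j <= n)%N -> 0 <= b j)
  (bp : forall j, (j <= n)%N -> b j <= 1 - p).

Let gw0 t k : (k <= n)%N -> 0 <= birth_coef t k * birth_weight k.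
Proof.
move=> kn; rewrite mulr_ge0 //; first by apply: (@birth_coef_ge0 n).
apply: prodr_ge0 => j _; have := bp (leq_trans (ltnW (ltn_ord j)) kn); move: p0; lra.
Qed.

(** While below [n + 1] the chain jumps with probability at least [p], so the
    generating function of its position, restricted to the states up to [n],
    is multiplied by at most [1 - p * (1 - theta)] at each step. *)
Lemma birth_mgf (theta : R) t : 0 <= theta -> theta <= 1 ->
  \sum_(k < n.+1) birth_coef t k * birth_weight k * theta ^+ k
    <= (1 - p * (1 - theta)) ^+ t.
Proof.
move=> th0 th1; have c0 : 0 <= 1 - p * (1 - theta) by move: p0 p1; nra.
elim: t => [|t IH].
  rewrite big_ord_recl /= big1 => [|i _]; last by rewrite !mul0r.
  by rewrite /birth_weight big_ord0 !mulr1 expr0 addr0.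
rewrite exprS; apply: le_trans (ler_wpM2l c0 IH).
pose u k := birth_coef t k * birth_weight k * theta ^+ k.
have u0 k : (k <= n)%N -> 0 <= u k.
  by move=> kn; rewrite mulr_ge0 ?gw0 ?exprn_ge0.
have e : \sum_(k < n.+1) birth_coef t.+1 k * birth_weight k * theta ^+ k =
    \sum_(k < n.+1) b k * u k + \sum_(k < n) (1 - b k) * theta * u k.
  pose v k := if k is k'.+1 then birth_coef t k' else 0.
  rewrite [X in _ + X](_ : \sum_(k < n) _ = \sum_(k < n.+1)
     v k * birth_weight k * theta ^+ k :> R).
    rewrite -big_split /=; apply: eq_bigr => k _.
    by rewrite /u -/(v k); ring.
  rewrite big_ord_recl /= !mul0r add0r; apply: eq_bigr => k _.
  by rewrite /bump /= add1n birth_weightS exprS /u; ring.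
rewrite e mulr_sumr.
have le1 : \sum_(k < n) (1 - b k) * theta * u k <=
    \sum_(k < n.+1) (1 - b k) * theta * u k.
  rewrite big_ord_recr /= lerDl mulr_ge0 ?u0 // mulr_ge0 //.
  by have := bp (leqnn n); move: p0; lra.
apply: le_trans (lerD (lexx _) le1) _.
rewrite -big_split /=; apply: ler_sum => k _.
have kn : (k <= n)%N by rewrite -ltnS.
rewrite -mulrDl ler_wpM2r ?u0 //.
by have := bp kn; have := b0 kn; move: p0 p1; nra.
Qed.

Lemma birth_tail (theta : R) t : 0 < theta -> theta <= 1 ->
  \sum_(k < n.+1) birth_coef t k * birth_weight k
    <= theta ^- n * (1 - p * (1 - theta)) ^+ t.
Proof.
move=> th0 th1; rewrite mulrC ler_pdivlMr ?exprn_gt0 //.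
apply: le_trans (birth_mgf t (ltW th0) th1).
rewrite mulr_suml; apply: ler_sum => k _.
have kn : (k <= n)%N by rewrite -ltnS.
apply: ler_wpM2l; first exact: gw0.
by apply: ler_wiXn2l => //; exact: ltW.
Qed.

(** With mu = t p, the choice theta = exp (- (mu - n) / mu) bounds the
    probability of being at most [n] by exp (- (mu - n)^2 / (2 mu)), and the
    hypothesis on mu makes the exponent at most [- L]. *)
Lemma birth_tail_le (L : R) t : 0 < L ->
  n%:R + 2 * L + Num.sqrt (2 * n%:R * L) <= t%:R * p ->
  \sum_(k < n.+1) birth_coef t k * birth_weight k <= expR (- L).
Proof.
move=> L0 ht; set mu := t%:R * p in ht.
have n0 : 0 <= n%:R :> R by exact: ler0n.
set r := Num.sqrt _ in ht.
have r0 : 0 <= r by exact: sqrtr_ge0.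
have rr : r ^+ 2 = 2 * n%:R * L by rewrite sqr_sqrtr //; nra.
have mu0 : 0 < mu by nra.
pose lam := (mu - n%:R) / mu.
have lmu : lam * mu = mu - n%:R by rewrite /lam divfK // gt_eqF.
have lam0 : 0 <= lam by rewrite divr_ge0 ?ltW //; nra.
apply: le_trans (@birth_tail (expR (- lam)) t _ _) _; first exact: expR_gt0.
  by rewrite expR_le1; lra.
set theta := expR (- lam).
have th1 : theta <= 1 by rewrite expR_le1; lra.
have th0 : 0 < theta by exact: expR_gt0.
have -> : theta ^- n = expR (n%:R * lam).
  by rewrite -exprVn -expRN opprK expRM_natl.
have h1 : (1 - p * (1 - theta)) ^+ t <= expR (- (mu * (1 - theta))).
  apply: le_trans (_ : expR (- (p * (1 - theta))) ^+ t <= _); last first.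
    by rewrite -expRM_natl /mu ler_expR; lra.
  apply: lerXn2r; rewrite ?nnegrE ?expR_ge0 //; first by move: p0 p1; nra.
  by apply: le_trans (expR_ge1Dx _); lra.
apply: le_trans (ler_wpM2l (expR_ge0 _) h1) _.
rewrite -expRD ler_expR.
have h2 := expRN_le_quadratic lam0; rewrite -/theta in h2.
have h3 : mu * (lam - lam ^+ 2 / 2) <= mu * (1 - theta).
  by apply: ler_wpM2l; [exact: ltW | lra].
suff : 2 * L * mu <= (mu - n%:R) ^+ 2.
  have -> : (mu - n%:R) ^+ 2 = mu * (mu * lam ^+ 2) by rewrite -lmu; ring.
  rewrite [2 * L * mu]mulrC (ler_pM2l mu0) => h4.
  have : n%:R * lam = mu * lam - mu * lam ^+ 2.
    have -> : n%:R = mu - lam * mu by rewrite lmu; ring.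
    by ring.
  lra.
have d : 2 * L + r <= mu - n%:R by lra.
have : (2 * L + r) * r <= (mu - n%:R) * (mu - n%:R - 2 * L).
  by apply: ler_pM => //; lra.
nra.
Qed.
End BirthChain.

(** * Mixing time bounds *)

(** A matrix with a nonzero cofactor has corank at most 1. *)
Lemma rank_adj_neq0 (F : fieldType) n (A : 'M[F]_n) :
  \adj A != 0 -> (n.-1 <= \rank A)%N.
Proof.
apply: contraNT; rewrite -ltnNge => rk; apply/eqP/matrixP => i j.
rewrite !mxE /cofactor; set B := row' j (col' i A).
suff : \det B == 0 by move/eqP ->; rewrite mulr0.
apply: contraLR rk => dB; rewrite -leqNgt.
have : B \in unitmx by rewrite unitmxE unitfE.
move/mxrank_unit <-; apply: leq_trans (mxrankS (rowsub_sub _ _)) _.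
by rewrite -mxrank_tr tr_col' -[\rank A]mxrank_tr; apply: mxrankS; exact: rowsub_sub.
Qed.

Lemma horner_char_poly_mx (F : comNzRingType) n (P : 'M[F]_n) x :
  map_mx (horner_eval x) (char_poly_mx P) = x%:M - P.
Proof.
by apply/matrixP => i j; rewrite !mxE rmorphB rmorphMn /= /horner_eval hornerX hornerC.
Qed.

(** The adjugate of [x - P], for an eigenvalue [x], is the Newton product over
    the spectrum with one copy of [x] removed: evaluating the Newton expansion
    at [x] kills all terms but the last. *)
Lemma adj_sub_newton (F : idomainType) n (P : 'M[F]_n) s x :
  char_poly P = \prod_(y <- rcons s x) ('X - y%:P) ->
  \adj (x%:M - P) = newton P s.
Proof.
move=> e; have sz := size_spectrum e; rewrite size_rcons in sz.
rewrite -horner_char_poly_mx -map_mx_adj (adj_char_poly_mx e) raddf_sum /=.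
case: n P e sz => // n P e [sz]; rewrite big_ord_recr /= big1 ?add0r => [|k _].
  rewrite drop_oversize ?size_rcons ?sz // big_nil scale1r -map_mx_comp.
  rewrite -cats1 take_size_cat //.
  by apply/matrixP => i j; rewrite !mxE /= /horner_eval hornerC.
have ks : (k.+1 <= size s)%N by rewrite sz.
rewrite -cats1 drop_cat; case: (ltnP k.+1 (size s)) => [_|ks1].
  apply/matrixP => i j; rewrite !mxE big_cat big_seq1 /= rmorphM /=.
  by rewrite rmorphM /= /horner_eval hornerXsubC subrr mulr0 mul0r.
have -> : (k.+1 - size s = 0)%N by lia.
by apply/matrixP => i j; rewrite !mxE drop0 big_seq1 /= rmorphM /=
  /horner_eval hornerXsubC subrr mul0r.
Qed.

Lemma newton_row_sum (R : realType) n (P : 'M[R]_n) s x : markov_matrix P ->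
  \sum_y newton P s x y = \prod_(z <- s) (1 - z).
Proof.
move=> [_ P1]; elim/last_ind: s => [|s z IH].
  rewrite newton_nil big_nil (bigD1 x) //= big1 ?addr0 => [|y /negbTE yx].
    by rewrite mxE eqxx.
  by rewrite mxE eq_sym yx.
rewrite newton_rcons -cats1 big_cat big_seq1 /= -IH.
under eq_bigr => y _ do rewrite mxE.
rewrite exchange_big mulr_suml; apply: eq_bigr => k _.
rewrite -mulr_sumr; congr (_ * _).
under eq_bigr => y _ do rewrite !mxE.
rewrite sumrB P1; congr (_ - _).
rewrite (bigD1 k) //= eqxx big1 ?addr0 => [|y /negbTE yx]; first by rewrite mulr1n.
by rewrite eq_sym yx.
Qed.

Lemma markov_row_sum_exp (R : realType) n (P : 'M[R]_n) t x : markov_matrix P ->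
  \sum_y (P ^+ t) x y = 1.
Proof.
move=> [P0 P1]; elim: t x => [|t IH] x.
  rewrite expr0 (bigD1 x) //= big1 ?addr0 => [|y /negbTE yx].
    by rewrite mxE eqxx.
  by rewrite mxE eq_sym yx.
rewrite exprS; under eq_bigr => y _ do rewrite mxE.
rewrite exchange_big /= -[RHS](P1 x); apply: eq_bigr => k _.
by rewrite -mulr_sumr IH mulr1.
Qed.

(** If 1 is a simple eigenvalue, the Newton product over the other eigenvalues
    is a multiple of the matrix with all rows equal to [pi].  Its rows are
    left fixed vectors of [P], and the space of these is the line of [pi],
    since [1 - P] has a nonzero adjugate. *)
Lemma newton_stationary (R : realType) n (P : 'M[R]_n) s (pi : 'rV[R]_n) :
  markov_matrix P -> stationary P pi ->
  char_poly P = \prod_(y <- rcons s 1) ('X - y%:P) ->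
  \prod_(z <- s) (1 - z) != 0 ->
  forall x y, newton P s x y = \prod_(z <- s) (1 - z) * pi 0 y.
Proof.
move=> mP [[pi0 pi1] piP] e q0 x y.
set q := \prod_(z <- s) _ in q0 *.
pose A := 1%:M - P.
have M0 : newton P s != 0.
  apply: contraNneq q0 => M0; rewrite /q -(newton_row_sum s x mP) M0.
  by rewrite big1 // => k _; rewrite mxE.
have rkA : (n.-1 <= \rank A)%N.
  by apply: rank_adj_neq0; rewrite (adj_sub_newton e).
have rkK : (\rank (kermx A) <= 1)%N.
  by rewrite mxrank_ker; lia.
have piK : (pi <= kermx A)%MS.
  by apply/sub_kermxP; rewrite mulmxBr mulmx1 piP subrr.
have pin0 : pi != 0.
  apply: contraTneq (oner_neq0 R) => p0; rewrite -pi1 p0 big1 ?eqxx // => k _.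
  by rewrite mxE.
have Kpi : (kermx A <= pi)%MS.
  have := mxrank_leqif_sup piK; rewrite rank_rV pin0 => -[_ <-].
  rewrite eqn_leq rkK andbT.
  by have := mxrankS piK; rewrite rank_rV pin0.
have wK : (row x (newton P s) <= pi)%MS.
  apply: submx_trans Kpi; apply/sub_kermxP.
  have := newton_full e; rewrite newton_rcons => h.
  by rewrite -row_mul -[A]opprB mulmxN h oppr0 row0.
have /sub_rVP [c hc] := wK.
have hM k : newton P s x k = c * pi 0 k.
  by have := congr1 (fun w : 'rV_n => w 0 k) hc; rewrite !mxE.
have -> : q = c.
  rewrite /q -(newton_row_sum s x mP).
  by under eq_bigr => k _ do rewrite hM; rewrite -mulr_sumr pi1 mulr1.
exact: hM.
Qed.

(** Newton expansion of a power of [P]; the term of index [n + 1] vanishes by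
    Cayley-Hamilton. *)
Lemma pow_newton (R : realType) n (P : 'M[R]_n.+1) s t :
  char_poly P = \prod_(y <- s) ('X - y%:P) ->
  P ^+ t = \sum_(k < n.+1) birth_coef (nth 0 s) t k *: newton P (take k s).
Proof.
move=> e; have sz := size_spectrum e.
elim: t => [|t IH].
  rewrite big_ord_recl big1 => [|k _]; last by rewrite /= scale0r.
  by rewrite /= take0 newton_nil scale1r addr0.
pose v k := if k is k'.+1 then birth_coef (nth 0 s) t k' else 0.
have step k : (k < n.+1)%N -> newton P (take k s) *m P =
    newton P (take k.+1 s) + nth 0 s k *: newton P (take k s).
  move=> ks; rewrite newton_take ?sz // mulmxBr mul_mx_scalar subrK //.
have nf : newton P (take n.+1 s) = 0.
  by rewrite take_oversize ?sz // (newton_full e).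
rewrite exprSr IH mulr_suml.
under eq_bigr => k _ do rewrite -mulmxE -scalemxAl step // scalerDr scalerA.
rewrite big_split /= big_ord_recr /= nf scaler0 addr0.
rewrite [X in X + _](_ : _ = \sum_(k < n.+1) v k *: newton P (take k s)).
  rewrite -big_split; apply: eq_bigr => k _ /=.
  by rewrite -scalerDl -/(v k) addrC [nth 0 s k * _]mulrC.
by rewrite big_ord_recl /= scale0r add0r.
Qed.

(** The powers of [P] dominate [(1 - eps) * pi] as soon as the birth chain is
    absorbed with probability at least [1 - eps]. *)
Lemma mixed_pow (R : realType) m (P : 'M[R]_m.+2) (pi : 'rV[R]_m.+2) s p eps t :
  markov_matrix P -> stationary P pi ->
  char_poly P = \prod_(y <- rcons s 1) ('X - y%:P) ->
  (forall k i j, 0 <= newton P (take k (rcons s 1)) i j) ->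
  0 < p -> p <= 1 -> {in s, forall y, 0 <= y <= 1 - p} ->
  0 < eps -> eps < 1 ->
  m%:R + 2 * ln (eps^-1) + Num.sqrt (2 * m%:R * ln (eps^-1)) <= t%:R * p ->
  mixed P pi eps t.
Proof.
move=> mP st e nP p0 p1 sp eps0 eps1 ht x.
have sz := size_spectrum e; rewrite size_rcons in sz; case: sz => sz.
have L0 : 0 < ln (eps^-1) by rewrite ln_gt0 // invf_gt1.
set b := nth 0 (rcons s 1).
have bE k : (k <= m)%N -> b k = nth 0 s k.
  by move=> km; rewrite /b nth_rcons sz ltnS km.
have bs k : (k <= m)%N -> 0 <= b k <= 1 - p.
  by move=> km; rewrite bE //; apply: sp; rewrite mem_nth ?sz.
have b0 k : (k <= m.+1)%N -> 0 <= b k.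
  rewrite leq_eqVlt => /orP[/eqP ->|]; last by rewrite ltnS => /bs /andP[].
  by rewrite /b nth_rcons sz ltnn eqxx.
(* Not absorbed: the chain is in one of the states 0, ..., [m]. *)
have tail : \sum_(k < m.+1) birth_coef b t k * birth_weight b k <= eps.
  have := @birth_tail_le R b m p (ltW p0) p1 _ _ (ln eps^-1) t L0 ht.
  rewrite -lnV ?posrE ?invr_gt0 // invrK lnK //; apply=> j jm.
    by apply: b0; exact: leqW.
  by have /andP[] := bs _ jm.
have bw k : (k <= m.+1)%N -> \prod_(z <- take k (rcons s 1)) (1 - z) = birth_weight b k.
  move=> km; rewrite (big_nth 0) size_takel ?size_rcons ?sz; last exact: leqW.
  rewrite big_mkord; apply: eq_bigr => i _; rewrite nth_take //.
have ts : take m.+1 (rcons s 1) = s by rewrite -cats1 take_size_cat.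
have wE : birth_weight b m.+1 = \prod_(z <- s) (1 - z) by rewrite -bw ?ts.
have w0 : \prod_(z <- s) (1 - z) != 0.
  rewrite prodf_seq_neq0; apply/allP => z zs /=.
  have /andP[_ zp] := sp z zs; rewrite gt_eqF //; lra.
(* The row sums of [P ^+ t] are 1, so the law of the chain has mass 1. *)
have tot : \sum_(k < m.+2) birth_coef b t k * birth_weight b k = 1.
  rewrite -(markov_row_sum_exp t x mP) (pow_newton t e).
  under [RHS]eq_bigr => y _ do rewrite summxE.
  rewrite exchange_big /=; apply: eq_bigr => k _.
  under eq_bigr => y _ do rewrite mxE.
  by rewrite -mulr_sumr newton_row_sum // bw // -ltnS.
have low y : (1 - eps) * pi 0 y <= (P ^+ t) x y.
  rewrite (pow_newton t e) summxE big_ord_recr /= mxE.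
  rewrite ts (newton_stationary mP st e w0).
  rewrite -[leLHS]add0r; apply: lerD.
    apply: sumr_ge0 => k _; rewrite mxE mulr_ge0 ?nP //.
    by apply: (@birth_coef_ge0 _ _ m.+1) => //; exact: ltnW.
  rewrite mulrA -wE; apply: ler_wpM2r; first by have [[]] := st.
  move: tot; rewrite big_ord_recr /= => tot; move: tail tot.
  by rewrite -/b; lra.
have [[pi0 pi1] _] := st.
have := markov_row_sum_exp t x mP => rs.
rewrite /tv_dist ler_pdivrMl //.
(* Both [P ^+ t] and [pi] exceed [(1 - eps) * pi] by a nonnegative measure of
   mass [eps]. *)
apply: le_trans (_ : \sum_y (((P ^+ t) x y - (1 - eps) * pi 0 y) + eps * pi 0 y) <= _).
  apply: ler_sum => y _; rewrite mxE.
  have := low y; have := pi0 y => py ly.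
  have ep : 0 <= eps * pi 0 y by rewrite mulr_ge0 // ltW.
  by rewrite ler_norml; apply/andP; split; lra.
by rewrite big_split sumrB /= rs -!mulr_sumr pi1; lra.
Qed.

Lemma beta_star_ge0 (R : realType) N (beta : 'I_N -> R) : 0 <= beta_star beta.
Proof.
apply: (big_ind (fun y : R => 0 <= y)) => // x y x0 y0; by rewrite le_max x0.
Qed.

Lemma beta_star_ge (R : realType) N (beta : 'I_N -> R) (j : 'I_N) :
  (j.+1 < N)%N -> `|beta j| <= beta_star beta.
Proof. by move=> jN; exact: (le_bigmax_cond 0 (fun j => `|beta j|)). Qed.

(** The sorted spectrum ends with the eigenvalue 1, and its other items are
    those that enter [beta_star]. *)
Lemma sorted_listing (R : realType) m (P : 'M[R]_m.+2) (beta : 'I_m.+2 -> R) s :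
  eigenvalue_listing P beta -> beta_star beta < 1 ->
  sorted <=%R s -> char_poly P = \prod_(x <- s) ('X - x%:P) ->
  exists s1, s = rcons s1 1 /\
    {in s1, forall x, exists2 j : 'I_m.+2, (j.+1 < m.+2)%N & x = beta j}.
Proof.
move=> [eb b1] hs ss es.
pose r := [seq beta (widen_ord (leqnSn _) j) | j <- enum 'I_m.+1].
have rP : {in sort <=%R r, forall x, exists2 j : 'I_m.+2, (j.+1 < m.+2)%N & x = beta j}.
  move=> x; rewrite mem_sort => /mapP[j _ ->].
  by exists (widen_ord (leqnSn _) j) => //=; rewrite ltnS.
exists (sort <=%R r); split=> //.
apply: (sorted_eq le_trans le_anti) => //.
  rewrite sorted_pairwise; last exact: le_trans.
  rewrite pairwise_rcons -sorted_pairwise; last exact: le_trans.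
  rewrite sort_le_sorted andbT; apply/allP => x /rP[j jN ->].
  apply: le_trans (ler_norm _) _; apply: le_trans (beta_star_ge beta jN) _.
  exact: ltW.
apply: prod_XsubC_eq; rewrite -es eb big_ord_recr /= -cats1 big_cat big_seq1 /=.
rewrite (perm_big _ (permEl (perm_sort _ r))) /r big_map big_enum.
by rewrite (b1 ord_max).
Qed.

(** Squaring is continuous and preserves reversibility. *)
Lemma sqr_closure (R : realType) N (P : 'M[R]_N) :
  closure (@reversible_markov R N) P -> closure (@reversible_markov R N) (P *m P).
Proof.
move=> hP B [/= U nU UB].
have ce i j : continuous (fun M : 'M[R]_N => (M *m M) i j).
  under eq_fun => M do rewrite mxE.
  apply: continuous_big => [|k _]; first exact: add_continuous.
  have cc := @coord_continuous R N N.
  by move=> M; apply: cvgM; [exact: mx_nbhs_filter | exact: (cc i k M) | exact: (cc k j M)].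
have FF : Filter (nbhs P) by exact: mx_nbhs_filter.
have nP : nbhs P [set M : 'M[R]_N | forall i j, U i j ((M *m M) i j)].
  have hi i : nbhs P [set M : 'M[R]_N | forall j, U i j ((M *m M) i j)].
    apply: (@filter_forall _ _ (fun j M => U i j ((M *m M) i j)) (nbhs P) FF) => j.
    exact: ce (nU i j).
  exact: (@filter_forall _ _ (fun i M => forall j, U i j ((M *m M) i j)) (nbhs P) FF).
have [Q [[[Q0 Q1] [pi [[dpi piQ] pi0 rev]]] /= UQ]] := hP _ nP.
exists (Q *m Q); split; last exact: UB.
split; first split.
- by move=> x y; rewrite mxE sumr_ge0 // => k _; rewrite mulr_ge0.
- move=> x; under eq_bigr => y _ do rewrite mxE.
  rewrite exchange_big /= -[RHS](Q1 x); apply: eq_bigr => k _.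
  by rewrite -mulr_sumr Q1 mulr1.
exists pi; split=> //; first by split=> //; rewrite mulmxA !piQ.
move=> x y; rewrite !mxE !mulr_sumr; apply: eq_bigr => k _.
by rewrite mulrA rev mulrAC rev mulrA.
Qed.

(** The determinant of [x^2 - P^2] is that of [x - P] times that of [x + P], and
    substituting [X^2] for [X] is injective on polynomials. *)
Lemma char_poly_sqr (R : realType) N (P : 'M[R]_N) (beta : 'I_N -> R) :
  char_poly P = \prod_(j < N) ('X - (beta j)%:P) ->
  char_poly (P *m P) = \prod_(j < N) ('X - (beta j ^+ 2)%:P).
Proof.
move=> e; have he x : \det (x%:M - P) = \prod_j (x - beta j).
  rewrite -horner_char_poly_mx det_map_mx -/(char_poly P) e /= /horner_eval horner_prod.
  by apply: eq_bigr => j _; rewrite hornerXsubC.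
set B := \prod_(j < N) _.
apply/eqP; rewrite -subr_eq0 -(@comp_poly_eq0 _ _ 'X^2) ?size_polyXn //.
apply/eqP/poly_fun_eq0 => x; rewrite horner_comp hornerXn hornerD hornerN.
have -> : (char_poly (P *m P)).[x ^+ 2] = \det ((x ^+ 2)%:M - P *m P).
  by rewrite -horner_char_poly_mx det_map_mx.
have -> : (x ^+ 2)%:M - P *m P = (x%:M - P) *m (-1 *: ((- x)%:M - P)).
  have -> : -1 *: ((- x)%:M - P) = x%:M + P.
    by rewrite scaleN1r opprB raddfN /= opprK addrC.
  rewrite mulmxDr !mulmxBl -scalar_mxM -expr2 mul_scalar_mx mul_mx_scalar.
  by rewrite addrA subrK.
have sgn : (-1) ^+ N = \prod_(j < N) (-1 : R) by rewrite prodr_const card_ord.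
rewrite det_mulmx detZ !he horner_prod sgn -!big_split /=.
apply/eqP; rewrite subr_eq0; apply/eqP; apply: eq_bigr => j _.
by rewrite hornerXsubC; ring.
Qed.

(** The time [t] is [(N - 2 + 2 L + sqrt (2 (N - 2) L)) / p], with [L] the
    logarithm of [1 / eps], rounded up; rounding adds at most 1, hence at most
    the relaxation time [1 / p]. *)
Lemma mixing_nonneg (R : realType) m (P : 'M[R]_m.+2) (beta : 'I_m.+2 -> R)
    (pi : 'rV[R]_m.+2) (eps : R) :
  closure (@reversible_markov R m.+2) P -> eigenvalue_listing P beta ->
  beta_star beta < 1 -> stationary P pi -> 0 < eps -> eps < 1 ->
  (forall j, 0 <= beta j) ->
  exists t : nat, mixed P pi eps t /\
    t%:R <= (m.+2%:R + 2 * ln (eps^-1) - 1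
             + Num.sqrt (2 * (m.+2%:R - 2) * ln (eps^-1))) * t_rel beta.
Proof.
move=> hP hb hs hpi eps0 eps1 b0.
have [s [ss es ns]] := closure_newton hP.
have [s1 [e1 hs1]] := sorted_listing hb hs ss es; rewrite {}e1 in ss es ns.
pose p := 1 - beta_star beta.
have p0 : 0 < p by rewrite subr_gt0.
have p1 : p <= 1 by rewrite lerBlDr lerDl beta_star_ge0.
have m2 : m.+2%:R - 2 = m%:R :> R by rewrite -addn2 natrD addrK.
set L := ln _; have L0 : 0 < L by rewrite ln_gt0 // invf_gt1.
rewrite m2; set r := Num.sqrt _; have r0 : 0 <= r by exact: sqrtr_ge0.
pose Y := (m%:R + 2 * L + r) / p.
have m0 : 0 <= m%:R :> R by exact: ler0n.
have Y0 : 0 <= Y by rewrite divr_ge0 ?ltW //; lra.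
have /andP[tl tu] := truncn_itv Y0.
exists (Num.truncn Y).+1; split.
  apply: (mixed_pow (closure_markov hP) hpi es ns p0 p1) => //.
    move=> y /hs1[j jN ->]; rewrite b0 /= /p opprB addrC subrK.
    exact: le_trans (ler_norm _) (beta_star_ge beta jN).
  by rewrite -ler_pdivrMr // ltW.
rewrite /t_rel -/p -natr1.
have -> : (m.+2%:R + 2 * L - 1 + r) / p = Y + p^-1.
  by rewrite /Y -addn2 natrD; field; rewrite gt_eqF.
by apply: lerD => //; rewrite invf_ge1.
Qed.

Local Unset Implicit Arguments.

(** The bound in general follows from the nonnegative case applied to [P^2], whose
    relaxation time is at most that of [P]; an even number of steps of [P] is
    then enough, which is where the factor 2 comes from. *)
Theorem theorem1p3 (R : realType) (N : nat) (hN : (2 <= N)%N)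
    (P : 'M[R]_N) (hP : closure (@reversible_markov R N) P)
    (beta : 'I_N -> R) (hbeta : eigenvalue_listing P beta)
    (hstar : beta_star beta < 1)
    (pi : 'rV[R]_N) (hpi : stationary P pi)
    (eps : R) (heps0 : 0 < eps) (heps1 : eps < 1) :
  exists t : nat,
    [/\ is_t_mix P pi eps t,
        t%:R <= 2 * (N%:R + 2 * ln (eps^-1) - 1
                     + Num.sqrt (2 * (N%:R - 2) * ln (eps^-1))) * t_rel beta
      & (forall j, 0 <= beta j) ->
        t%:R <= (N%:R + 2 * ln (eps^-1) - 1
                 + Num.sqrt (2 * (N%:R - 2) * ln (eps^-1))) * t_rel beta].
Proof.
case: N hN P hP beta hbeta hstar pi hpi => [|[|m]] // _ P hP beta hbeta hstar pi hpi.
pose beta2 j := beta j ^+ 2.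
have bs0 := beta_star_ge0 beta.
have bs2 : beta_star beta2 <= beta_star beta.
  apply: bigmax_le => // j jN; rewrite /beta2 normrX expr2.
  have := beta_star_ge beta jN; have := normr_ge0 (beta j); nra.
have hbeta2 : eigenvalue_listing (P *m P) beta2.
  split; first exact: char_poly_sqr hbeta.1.
  by move=> j jN; rewrite /beta2 hbeta.2 // expr1n.
have hpi2 : stationary (P *m P) pi.
  by case: hpi => dpi e; split=> //; rewrite mulmxA !e.
have [t2 [mix2 le2]] := mixing_nonneg (sqr_closure hP) hbeta2 (le_lt_trans bs2 hstar)
  hpi2 heps0 heps1 (fun j => sqr_ge0 (beta j)).
have mix2' : mixed P pi eps (2 * t2)%N.
  by move=> x; rewrite exprM expr2; exact: mix2.
pose mb t := `[< mixed P pi eps t >].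
have ex : exists t, mb t by exists (2 * t2)%N; apply/asboolP.
case: (ex_minnP ex) => t /asboolP mt tmin.
have tle s : mixed P pi eps s -> (t <= s)%N by move=> ms; apply: tmin; apply/asboolP.
exists t; split=> //.
  have : t%:R <= 2 * t2%:R :> R by rewrite -natrM ler_nat; exact: tle.
  move/le_trans; apply; rewrite -mulrA ler_pM2l //.
  apply: le_trans le2 _; apply: ler_wpM2l.
    have L0 : 0 < ln (eps^-1) by rewrite ln_gt0 // invf_gt1.
    apply: addr_ge0 (sqrtr_ge0 _).
    rewrite -addn2 natrD; have : 0 <= m%:R :> R by exact: ler0n.
    lra.
  by rewrite /t_rel lef_pV2 ?posrE ?subr_gt0 ?lerD2l ?lerN2 // (le_lt_trans bs2).
move=> b0; have [t1 [mix1 le1]] := mixing_nonneg hP hbeta hstar hpi heps0 heps1 b0.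
by apply: le_trans le1; rewrite ler_nat; exact: tle.
Qed.
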